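(* Let $r\ge 1$ and $m\ge 1$ be integers and let $G$ be a finite simple graph. If $G$ is $r$-EKR, then the lexicographic product $G[K_m]$ of $G$ with the complete graph $K_m$ is $r$-EKR.
   Context: All graphs are simple (no loops or multiple edges) with finite vertex set. For a graph $G$ and an integer $r\ge 1$, $\mathcal{I}^{(r)}(G)$ denotes the family of independent sets $A\subseteq V(G)$ (sets containing no edge) with $|A|=r$. For $v\in V(G)$, $\mathcal{I}_v^{(r)}(G)=\{A\in\mathcal{I}^{(r)}(G): v\in A\}$; such a family is called a star. A family $\mathcal{A}$ of sets is intersecting if $A\cap B\neq\emptyset$ for all $A,B\in\mathcal{A}$. The graph $G$ is $r$-EKR if no intersecting family $\mathcal{A}\subseteq\mathcal{I}^{(r)}(G)$ is larger than the largest star in $\mathcal{I}^{(r)}(G)$. The lexicographic product $G[H]$ has vertex set $V(G)\times V(H)$, where $(v,w)$ is adjacent to $(x,y)$ if and only if either $v$ is adjacent to $x$ in $G$, or $v=x$ and $w$ is adjacent to $y$ in $H$. *)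

(* Defs.v *)
From mathcomp Require Import all_boot.

Set Implicit Arguments.
Unset Strict Implicit.
Unset Printing Implicit Defensive.

Record sgraph := SGraph {
  vertex :> finType;
  adj : rel vertex;
  adj_sym : symmetric adj;
  adj_irr : irreflexive adj
}.

Arguments adj {s} x y.

Definition independent (G : sgraph) (A : {set G}) : bool :=
  [forall x in A, forall y in A, ~~ adj x y].

Definition indep_sets (G : sgraph) (r : nat) : {set {set G}} :=
  [set A : {set G} | independent A && (#|A| == r)].

Definition star (G : sgraph) (r : nat) (v : G) : {set {set G}} :=
  [set A in indep_sets G r | v \in A].

Definition intersecting (T : finType) (F : {set {set T}}) : Prop :=
  forall A B : {set T}, A \in F -> B \in F -> A :&: B != set0.

(* If G has no vertex, hence no star, the maximum below is 0. *)
Definition EKR (r : nat) (G : sgraph) : Prop :=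
  forall F : {set {set G}},
    F \subset indep_sets G r -> intersecting F ->
    #|F| <= \max_(v : G) #|star r v|.

Section Complete.
Variable m : nat.

Definition complete_adj : rel 'I_m := fun i j => i != j.

Lemma complete_adj_sym : symmetric complete_adj.
Proof. by move=> i j; rewrite /complete_adj eq_sym. Qed.

Lemma complete_adj_irr : irreflexive complete_adj.
Proof. by move=> i; rewrite /complete_adj eqxx. Qed.

Definition complete_graph : sgraph := SGraph complete_adj_sym complete_adj_irr.

End Complete.

Section Lex.
Variables G H : sgraph.

Definition lex_adj : rel (G * H) :=
  fun p q => adj p.1 q.1 || ((p.1 == q.1) && adj p.2 q.2).

Lemma lex_adj_sym : symmetric lex_adj.
Proof.
by move=> p q; rewrite /lex_adj adj_sym (eq_sym p.1) (@adj_sym H p.2).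
Qed.

Lemma lex_adj_irr : irreflexive lex_adj.
Proof. by move=> p; rewrite /lex_adj !adj_irr andbF. Qed.

Definition lex_product : sgraph := SGraph lex_adj_sym lex_adj_irr.

End Lex.

(* Main.v *)
(** Write [n] for the order of [G]. For a colouring [c : V(G) -> Z/m] and a
    shift [j], the graph of [c + j] carries a copy of [G] inside [G[K_m]]; the
    [m] copies obtained from the same [c] are pairwise disjoint. Hence, if [F] is
    intersecting, the pairs [(j, B)] with [B] in [F] lying on the graph of
    [c + j] project injectively onto an intersecting family of [G], so there are
    at most [max_v |star v|] of them. If [F] is the star of [(v, w)] there are at
    least [|star v|] of them. Every [B] lies on the graph of [m^(n - r)]
    colourings, so summing over [c] compares [F] with a star of [G[K_m]]. *)
Require Import Defs.
From mathcomp Require Import all_boot.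
From mathcomp Require Import all_algebra.

Import GRing.Theory.

Section IndependentSets.
Variable G : sgraph.

Lemma independentP (A : {set G}) :
  reflect {in A &, forall x y, ~~ adj x y} (independent A).
Proof.
apply: (iffP forall_inP) => [h x y xA yA|h x xA].
  by move/forall_inP: (h x xA); apply.
by apply/forall_inP => y; apply: h.
Qed.

Lemma indep_setsP r (A : {set G}) :
  reflect ({in A &, forall x y, ~~ adj x y} /\ #|A| = r) (A \in indep_sets G r).
Proof.
rewrite inE; apply: (iffP andP) => -[].
  by move=> /independentP ? /eqP.
by move=> ? ->; split=> //; apply/independentP.
Qed.

End IndependentSets.

Section Lex.
Variables (G : sgraph) (m r : nat).
(** The successor form [m.+1] makes ['I_m.+1] a cyclic group, so that shifts of colourings can be
    added and subtracted. *)
Local Notation L := (lex_product G (complete_graph m.+1)).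
Local Notation colouring := {ffun G -> 'I_m.+1}.
Implicit Types (c : colouring) (j : 'I_m.+1) (B : {set L}) (F : {set {set L}}).

Definition on_graph c j B := [forall p in B, p.2 == (c p.1 + j)%R].

Lemma on_graphP c j B :
  reflect {in B, forall p, p.2 = (c p.1 + j)%R} (on_graph c j B).
Proof. by apply: (iffP forall_inP) => h p pB; apply/eqP; apply: h. Qed.

Definition vertices B : {set G} := [set p.1 | p in B].

Definition lift c j (A : {set G}) : {set L} := [set (v, (c v + j)%R) | v in A].

(** Each fibre over a vertex of [G] is a clique, so an independent set meets it at most once. *)
Lemma indep_fst_inj B : B \in indep_sets L r -> {in B &, injective fst}.
Proof.
move=> /indep_setsP[indB _] [v i] [w k] pB qB /= vw; subst w.
have := indB _ _ pB qB; rewrite /adj /= /lex_adj /= adj_irr eqxx /=.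
by rewrite /complete_adj negbK => /eqP ->.
Qed.

Lemma vertices_indep B :
  B \in indep_sets L r -> vertices B \in indep_sets G r.
Proof.
move=> BL; have injB := indep_fst_inj B BL; move/indep_setsP: BL => [indB cB].
apply/indep_setsP; split; last by rewrite card_in_imset.
move=> _ _ /imsetP[p pB ->] /imsetP[q qB ->].
by have := indB _ _ pB qB; rewrite {1}/adj /= /lex_adj negb_or => /andP[].
Qed.

Lemma lift_indep c j A : A \in indep_sets G r -> lift c j A \in indep_sets L r.
Proof.
move=> /indep_setsP[indA cA]; apply/indep_setsP; split; last first.
  by rewrite card_imset // => v w [].
move=> _ _ /imsetP[v vA ->] /imsetP[w wA ->].
rewrite /adj /= /lex_adj /= negb_or indA //=.
by case: eqP => //= ->; rewrite /complete_adj eqxx.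
Qed.

Lemma vertices_lift c j A : vertices (lift c j A) = A.
Proof.
rewrite /vertices -imset_comp -[RHS]imset_id.
by apply: eq_imset => v.
Qed.

Lemma on_graph_lift c j A : on_graph c j (lift c j A).
Proof. by apply/on_graphP => _ /imsetP[v _ ->]. Qed.

Lemma lift_vertices c j B : on_graph c j B -> lift c j (vertices B) = B.
Proof.
move=> /on_graphP cB; rewrite /lift /vertices -imset_comp -[RHS]imset_id.
by apply: eq_in_imset => -[v i] /cB /= ->.
Qed.

(** The colour is forced at each vertex below [B] and free at all others. The truncated difference
    is exact, since [vertices B] has [r] elements. *)
Lemma card_on_graph j B :
  B \in indep_sets L r ->
  #|[set c | on_graph c j B]| = m.+1 ^ (#|G| - r).
Proof.
move=> BL.
(* The colours allowed at [v]: the condition on [c] splits vertex by vertex, so the count is a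
   product. *)
pose vals (v : G) : pred 'I_m.+1 :=
  [pred i | (v \in vertices B) ==> ((v, (i + j)%R) \in B)].
have -> : #|[set c | on_graph c j B]| = #|family vals|.
  apply: eq_card => c; rewrite inE; apply/on_graphP/familyP => [cB v|cB p pB].
    rewrite inE; apply/implyP => /imsetP[[w i] pB ->] /=.
    by rewrite -(cB _ pB).
  have /implyP := cB p.1; rewrite imset_f // => /(_ isT) qB.
  by have /= <- := indep_fst_inj B BL _ _ qB pB erefl.
have card_vals v : #|vals v| = if v \in vertices B then 1 else m.+1.
  case: ifP => vB; last first.
    by rewrite -[RHS]card_ord; apply: eq_card => i; rewrite inE vB.
  have /imsetP[[w k] pB /= vw] := vB; subst w.
  (* [B] meets the fibre over [w] only in [(w, k)], which leaves the single colour [k - j]. *)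
  rewrite -(card1 (k - j)%R); apply: eq_card => i; rewrite !inE vB /=.
  apply/idP/eqP => [qB|->]; last by rewrite subrK.
  by have [<-] := indep_fst_inj B BL _ _ qB pB erefl; rewrite addrK.
rewrite card_family foldrE big_map big_enum /=.
under eq_bigr do rewrite card_vals.
rewrite (bigID (mem (vertices B))) /= big1 => [|v ->//]; rewrite mul1n.
under eq_bigr => v /negbTE vB do rewrite vB.
rewrite prod_nat_const; congr (_ ^ _).
have /indep_setsP[_ <-] := vertices_indep B BL.
by rewrite -(cardC (mem (vertices B))) addKn; apply: eq_card.
Qed.

Definition slices F c : {set 'I_m.+1 * {set L}} :=
  [set q | (q.2 \in F) && on_graph c q.1 q.2].

(** Double counting of the triples [(c, j, B)]: each pair [(j, B)] with [B] in [F] lies in equally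
    many slices. *)
Lemma sum_card_slices F :
  F \subset indep_sets L r ->
  \sum_c #|slices F c| = m.+1 * #|F| * m.+1 ^ (#|G| - r).
Proof.
move=> /subsetP FL.
under eq_bigr do rewrite -sum1_card big_mkcond /=.
rewrite exchange_big /=.
transitivity (\sum_(q in setX [set: 'I_m.+1] F) m.+1 ^ (#|G| - r)).
  rewrite [RHS]big_mkcond /=; apply: eq_bigr => -[j B] _.
  rewrite in_setX in_setT /=; case: ifP => BF.
    rewrite -(card_on_graph j B (FL _ BF)) -sum1_card [RHS]big_mkcond /=.
    by apply: eq_bigr => c _; rewrite !inE BF.
  by rewrite big1 // => c _; rewrite inE BF.
by rewrite sum_nat_const cardsX cardsT card_ord.
Qed.

Lemma card_slices_intersecting F c :
  EKR r G -> F \subset indep_sets L r -> intersecting F ->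
  #|slices F c| <= \max_(v : G) #|star r v|.
Proof.
move=> ekrG /subsetP FL intF.
have inj : {in slices F c &, injective (vertices \o snd)}.
  move=> [j B] [k C]; rewrite !inE /= => /andP[BF cB] /andP[CF cC] eqBC.
  have /set0Pn[p /setIP[pB pC]] := intF _ _ BF CF.
  (* A common point [p] determines the shift as [p.2 - c p.1]; the shift and the projection then
     determine the set. *)
  have jk : j = k.
    apply: (@addrI _ (c p.1)).
    by rewrite -(on_graphP _ _ _ cB p pB) -(on_graphP _ _ _ cC p pC).
  by rewrite -(lift_vertices _ _ _ cB) -(lift_vertices _ _ _ cC) eqBC jk.
rewrite -(card_in_imset inj); apply: ekrG.
  apply/subsetP => _ /imsetP[[j B] + ->]; rewrite inE => /andP[BF _].
  by apply: vertices_indep; apply: FL.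
move=> _ _ /imsetP[[j B] + ->] /imsetP[[k C] + ->].
rewrite !inE => /andP[BF _] /andP[CF _].
have /set0Pn[p /setIP[pB pC]] := intF _ _ BF CF.
by apply/set0Pn; exists p.1; rewrite inE !imset_f.
Qed.

Lemma card_slices_star c (p : L) :
  #|star r p.1| <= #|slices (star r p) c|.
Proof.
(* With this shift the graph of [c + j] passes through [p], so lifting sends the star of [p.1] into
   the star of [p]. *)
pose j := (p.2 - c p.1)%R.
rewrite -(card_imset (star r p.1) (can_inj (vertices_lift c j))).
have injj : injective (pair j : {set L} -> _) by move=> ? ? [].
rewrite -(card_imset _ injj).
apply/subset_leq_card/subsetP => _ /imsetP[_ /imsetP[A + ->] ->].
rewrite inE => /andP[AG pA]; rewrite inE on_graph_lift andbT inE lift_indep //=.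
by apply/imsetP; exists p.1 => //; rewrite addrC subrK -surjective_pairing.
Qed.

Lemma EKR_lex_complete : EKR r G -> EKR r L.
Proof.
move=> ekrG F FL intF.
have leF : \sum_c #|slices F c| <= \sum_(c : colouring) \max_(v : G) #|star r v|.
  by apply: leq_sum => c _; apply: card_slices_intersecting.
rewrite sum_card_slices // sum_nat_const in leF.
have pos : 0 < m.+1 * m.+1 ^ (#|G| - r) by rewrite muln_gt0 expn_gt0.
(* Without vertices there is no maximal star to pick; the bound is then 0 and forces [F] to be
   empty. *)
have [G0|Gpos] := posnP #|G|.
  have max0 : \max_(v : G) #|star r v| = 0.
    by apply: big1 => v; have := card0_eq G0 v.
  by move: leF; rewrite max0 muln0 leqn0 mulnAC muln_eq0 eqn0Ngt pos => /eqP ->.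
have [v maxv] := eq_bigmax (fun v : G => #|star r v|) Gpos.
rewrite maxv in leF.
apply: leq_trans (@leq_bigmax L (fun p => #|star r p|) (v, ord0)).
have starL : star r ((v, ord0) : L) \subset indep_sets L r.
  by apply/subsetP => B; rewrite inE => /andP[].
(* Scaling by the common factor turns both cardinalities into totals over all colourings. *)
rewrite -(leq_pmul2l pos) mulnAC [leqRHS]mulnAC -(sum_card_slices _ starL).
apply: leq_trans leF _.
by rewrite -sum_nat_const; apply: leq_sum => c _; apply: card_slices_star.
Qed.

End Lex.

Theorem theorem6 (r m : nat) (G : sgraph) (hr : 1 <= r) (hm : 1 <= m) :
  EKR r G -> EKR r (lex_product G (complete_graph m)).
Proof. by case: m hm => // m _; apply: EKR_lex_complete. Qed.
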